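(* Let $N\ge3$, $p\in[1,\frac N{N-2})$, $\Omega\subset\mathbb{R}^N$ a bounded domain of class $C^{2,\beta}$ with $|\Omega|=1$, and let $(\alpha_n,\psi_n)$ be solutions of $(\mathbf{P}_{\lambda_n})$ with $\alpha_n<0$ and $|\alpha_n|\to+\infty$. Then $\lambda_n\to+\infty$ and $\lambda_n\|\psi_n\|_\infty\to+\infty$.
   Context: Problem $(\mathbf{P}_\lambda)$ ($\lambda>0$): find $(\alpha,\psi)\in\mathbb{R}\times C^{2,\beta}(\overline\Omega)$ with $-\Delta\psi=[\alpha+\lambda\psi]_+^p$ in $\Omega$, $\psi=0$ on $\partial\Omega$, $\int_\Omega[\alpha+\lambda\psi]_+^p=1$, where $[t]_+=\max\{t,0\}$. *)

(* Defs.v *)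
From HB Require Import structures.
From mathcomp Require Import all_boot all_order all_algebra.
From mathcomp Require Import all_classical all_reals all_analysis.
Set Implicit Arguments. Unset Strict Implicit. Unset Printing Implicit Defensive.
Import Order.TTheory GRing.Theory Num.Theory.
Import numFieldNormedType.Exports.
Local Open Scope classical_set_scope.
Local Open Scope ring_scope.

Section Defs.
Variable R : realType.

Definition evec (N : nat) (i : 'I_N) : 'rV[R]_N := delta_mx 0 i.

Definition pd (N : nat) (i : 'I_N) (f : 'rV[R]_N -> R) : 'rV[R]_N -> R :=
  fun x => 'D_(evec i) f x.

Definition laplacian (N : nat) (f : 'rV[R]_N -> R) : 'rV[R]_N -> R :=
  fun x => \sum_(i < N) pd i (pd i f) x.

Definition holder_on (N : nat) (U : set 'rV[R]_N) (beta : R) (g : 'rV[R]_N -> R) :=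
  exists C : R, forall x y, U x -> U y -> `|g x - g y| <= C * (`|x - y| `^ beta).
Definition bounded_on (N : nat) (U : set 'rV[R]_N) (g : 'rV[R]_N -> R) :=
  exists M : R, forall x, U x -> `|g x| <= M.

Definition C2beta (N : nat) (U : set 'rV[R]_N) (beta : R) (u : 'rV[R]_N -> R) :=
  [/\ forall x, U x -> forall i : 'I_N,
        derivable u x (evec i) /\ forall j : 'I_N, derivable (pd i u) x (evec j),
      bounded_on U u /\ holder_on U beta u,
      forall i : 'I_N, bounded_on U (pd i u) /\ holder_on U beta (pd i u) &
      forall i j : 'I_N, bounded_on U (pd j (pd i u)) /\ holder_on U beta (pd j (pd i u))].

Definition C2beta_closure (N : nat) (U : set 'rV[R]_N) (beta : R) (u : 'rV[R]_N -> R) :=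
  C2beta U beta u /\ {within closure U, continuous u}.

(* topological boundary of an open set *)
Definition bdry (N : nat) (U : set 'rV[R]_N) : set 'rV[R]_N := closure U `\` U.

(* bounded domain of class C^{2,beta} (Gilbarg--Trudinger, Sect. 6.2):
   for each boundary point x0 there are a ball B around x0 and a map Psi,
   one-to-one on B with inverse Phi, such that Psi(B /\ Omega) lies in the
   half space {y_i > 0}, Psi(B /\ bdry Omega) lies in {y_i = 0},
   Psi in C^{2,beta}(B) and Psi^{-1} = Phi in C^{2,beta}(Psi(B)). *)
Definition C2beta_bounded_domain (N : nat) (beta : R) (Omega : set 'rV[R]_N) :=
  [/\ open Omega, connected Omega, bounded_set Omega &
      forall x0, bdry Omega x0 ->
        exists r : R, 0 < r /\
        exists (Psi Phi : 'rV[R]_N -> 'rV[R]_N) (i : 'I_N),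
          [/\ forall x, ball x0 r x -> Phi (Psi x) = x,
              forall x, ball x0 r x -> Omega x -> 0 < Psi x 0 i,
              forall x, ball x0 r x -> bdry Omega x -> Psi x 0 i = 0,
              forall k : 'I_N, C2beta (ball x0 r) beta (fun x => Psi x 0 k) &
              forall k : 'I_N, C2beta (Psi @` ball x0 r) beta (fun y => Phi y 0 k)]].

(* iterated Lebesgue integral over R^N of an extended-real function; for
   nonnegative Borel functions this is the N-dimensional Lebesgue integral
   (Tonelli). *)
Fixpoint iint (n : nat) : ('rV[R]_n -> \bar R) -> \bar R :=
  match n with
  | 0 => fun f => f 0
  | n'.+1 => fun f =>
      (\int[@lebesgue_measure R]_(t in setT)
         iint (fun v : 'rV[R]_n' =>
                 f (\row_(k < n'.+1) match unlift ord0 k with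
                                     | Some j => v ord0 j
                                     | None => t end)))%E
  end.

Definition vol (N : nat) (A : set 'rV[R]_N) : \bar R := iint (fun x => (\1_A x)%:E).

Definition posp (t p : R) : R := (Num.max t 0) `^ p.

Definition solves_P (N : nat) (Omega : set 'rV[R]_N) (beta p lambda alpha : R)
    (psi : 'rV[R]_N -> R) :=
  [/\ C2beta_closure Omega beta psi,
      forall x, Omega x -> - laplacian psi x = posp (alpha + lambda * psi x) p,
      forall x, bdry Omega x -> psi x = 0 &
      iint (fun x => (\1_Omega x * posp (alpha + lambda * psi x) p)%:E) = 1%E].

Definition supnorm (N : nat) (Omega : set 'rV[R]_N) (psi : 'rV[R]_N -> R) : R :=
  sup [set `|psi x| | x in Omega].

End Defs.

(* Main.v *)
Require Import Defs.
From HB Require Import structures.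
From mathcomp Require Import all_boot all_order all_algebra.
From mathcomp Require Import all_classical all_reals all_analysis.
From mathcomp Require Import measurable_realfun ring lra zify.
Import Order.TTheory GRing.Theory Num.Theory.
Import numFieldNormedType.Exports.
Local Open Scope classical_set_scope.
Local Open Scope ring_scope.

(** The integral constraint forces [u = alpha + lambda psi] to be positive
    somewhere, so [lambda sup psi > |alpha|]: this is the second limit.  For the
    first it suffices to bound [|alpha|] when [lambda <= L].  Let [M = sup u].
    Extended by zero, [u_+] satisfies [Delta u_+ >= - L M^p], so a mean value
    inequality at scale [r] gives [M <= c (average of u_+) + c L M^p r^2], and
    the average is at most [c r^{-N/p}] because [u_+^p] has integral one.  With
    [r^2 ~ M^{1-p} / L] this bounds [M], precisely because [p < N / (N - 2)].
    Then [- Delta psi <= M^p], comparison with a quadratic polynomial bounds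
    [psi], and [|alpha| < lambda sup psi <= L sup psi].

    The mean value inequality is proved on a lattice, for averages over boxes
    centred at a point, seen as functions of the half-widths.  Summation by parts
    shows that the sum of discrete three-dimensional radial Laplacians in each
    half-width turns the average of [F] into the average of the Laplacian of [F].
    The maximum principle, with the power [2 / N] of the volume of the box as a
    barrier, then compares [F] at the centre with its averages over boxes of
    volume at least [P].  Lower sums suffice to compare these averages with the
    iterated integral, so no measurability has to be checked. *)

(** * Lattice box averages and the discrete mean value inequality *)

Section BoxAverages.
Context {R : realType} {V : zmodType}.
Implicit Types (F G : V -> R) (d e x : V).

Definition diff2 e F : V -> R := fun x => F (x + e) + F (x - e) - 2 * F x.

Fixpoint segsum e k F : V -> R := fun x =>
  if k is k'.+1 then segsum e k' F x + (F (x + e *+ k) + F (x - e *+ k)) else F x.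

Definition segavg e k F : V -> R := fun x => segsum e k F x / (2 * k%:R + 1).

(** Second differences telescope along the segment, leaving only the increments at its two ends. *)
Lemma segsum_diff2 e k F x :
  segsum e k (diff2 e F) x =
  F (x + e *+ k.+1) + F (x - e *+ k.+1) - (F (x + e *+ k) + F (x - e *+ k)).
Proof.
elim: k => [|k IH] /=; first by rewrite /diff2 mulr0n mulr1n addr0 subr0; ring.
rewrite IH /diff2.
have -> : x + e *+ k.+1 + e = x + e *+ k.+2 by rewrite -addrA -mulrSr.
have -> : x + e *+ k.+1 - e = x + e *+ k by rewrite -addrA mulrSr addrK.
have -> : x - e *+ k.+1 + e = x - e *+ k by rewrite mulrSr opprD addrA subrK.
have -> : x - e *+ k.+1 - e = x - e *+ k.+2.
  by rewrite (mulrSr e k.+1) opprD addrA.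
ring.
Qed.

(* The discrete Darboux equation: in the half-width, segment averages satisfy
   the radial Laplace equation of dimension three.  At [k = 0] the weight of
   [k.-1 = 0] is negative but multiplies a zero difference. *)
Lemma segavg_darboux e k F x :
  let m := 2 * k%:R + 1 in
  (m + 2) * (segavg e k.+1 F x - segavg e k F x)
  + (m - 2) * (segavg e k.-1 F x - segavg e k F x) = m * segavg e k (diff2 e F) x.
Proof.
move=> m; rewrite /segavg segsum_diff2.
have m0 j : 2 * j%:R + 1 != 0 :> R by rewrite gt_eqF// ltr_wpDl// mulr_ge0.
case: k @m => [|k] m /=.
  by rewrite /m !mulr0n !mulr1n addr0 subr0; field.
have h1 := m0 k; have h2 := m0 k.+1; have h3 := m0 k.+2.
have E1 : k.+1%:R = k%:R + 1 :> R by rewrite natr1.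
have E2 : k.+2%:R = k%:R + 2 :> R by rewrite -natrD addn2.
rewrite /m; move: h1 h2 h3; rewrite E2 E1 => h1 h2 h3; field.
by rewrite h1 h2 h3.
Qed.

Lemma le_segavg e k F G x :
  (forall y, F y <= G y) -> segavg e k F x <= segavg e k G x.
Proof.
move=> FG; rewrite ler_wpM2r ?invr_ge0 ?addr_ge0 ?mulr_ge0//.
by elim: k => //= k IH; rewrite lerD// lerD.
Qed.

Lemma segavg_cst e k (c : R) x : segavg e k (fun=> c) x = c.
Proof.
have m0 : 2 * k%:R + 1 != 0 :> R by rewrite gt_eqF// ltr_wpDl// mulr_ge0.
apply: (canLR (mulfK m0)); elim: k {m0} => /= [|k ->]; first by ring.
by rewrite -natr1; ring.
Qed.

Lemma segavg_lin e k (a b : R) F G x :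
  segavg e k (fun y => a * F y + b * G y) x = a * segavg e k F x + b * segavg e k G x.
Proof.
rewrite /segavg !mulrA -mulrDl; congr (_ / _).
by elim: k => //= k ->; ring.
Qed.

Lemma segavg_sum (J : finType) e k (H : J -> V -> R) x :
  segavg e k (fun y => \sum_j H j y) x = \sum_j segavg e k (H j) x.
Proof.
rewrite /segavg -mulr_suml; congr (_ / _).
by elim: k => //= k ->; rewrite -!big_split.
Qed.

(** Translations of an abelian group commute. This lets any direction be brought to the front of
    [boxavg]. *)
Lemma segavgC d e k l F : segavg d k (segavg e l F) = segavg e l (segavg d k F).
Proof.
apply/funext => x; rewrite /segavg.
pose c (j : nat) := (2 * j%:R + 1 : R)^-1.
have sumZ f j G c' y : segsum f j (fun z => G z * c') y = segsum f j G y * c'.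
  by elim: j => //= j ->; rewrite !mulrDl.
rewrite !sumZ mulrAC; congr (_ / _ / _).
have sumD f j G H y : segsum f j (fun z => G z + H z) y = segsum f j G y + segsum f j H y.
  by elim: j => //= j ->; ring.
have sumS f j G t y : segsum f j (fun z => G (z + t)) y = segsum f j G (y + t).
  elim: j => //= j ->; congr (_ + (G _ + G _)); by rewrite addrAC.
elim: l x => //= l IH x.
by rewrite sumD IH sumD !sumS.
Qed.

Lemma segavg_diff2 d e k F : diff2 d (segavg e k F) = segavg e k (diff2 d F).
Proof.
apply/funext => x; rewrite /segavg /diff2.
transitivity ((segsum e k F (x + d) + segsum e k F (x - d) - 2 * segsum e k F x)
  / (2 * k%:R + 1)); first by ring.
congr (_ / _); elim: k => //= k <-.
by rewrite ![x + d + _]addrAC ![x - d + _]addrAC; ring.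
Qed.


Section Multi.
Context {I : finType} (e : I -> V).
Implicit Types (i : I) (s : seq I).

Definition boxavg (k : I -> nat) s F : V -> R :=
  foldr (fun i => segavg (e i) (k i)) F s.

Lemma le_boxavg (k : I -> nat) s F G x :
  (forall y, F y <= G y) -> boxavg k s F x <= boxavg k s G x.
Proof. by move=> FG; elim: s x => //= i s IH x; exact: le_segavg. Qed.

Lemma boxavg_cst (k : I -> nat) s (c : R) x : boxavg k s (fun=> c) x = c.
Proof.
suff -> : boxavg k s (fun=> c) = fun=> c by [].
by elim: s => //= i s ->; apply/funext => y; rewrite segavg_cst.
Qed.

Lemma boxavg_lin (k : I -> nat) s (a b : R) F G x :
  boxavg k s (fun y => a * F y + b * G y) x = a * boxavg k s F x + b * boxavg k s G x.
Proof.
elim: s x => //= i s IH x; rewrite -segavg_lin; congr segavg.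
by apply/funext => y; rewrite IH.
Qed.

Lemma boxavg_sum (k : I -> nat) s (J : finType) (H : J -> V -> R) x :
  boxavg k s (fun y => \sum_j H j y) x = \sum_j boxavg k s (H j) x.
Proof.
elim: s x => //= i s IH x; rewrite -segavg_sum; congr segavg.
by apply/funext => y; rewrite IH.
Qed.

Lemma diff2_boxavg (k : I -> nat) s d F : diff2 d (boxavg k s F) = boxavg k s (diff2 d F).
Proof. by elim: s => //= i s IH; rewrite segavg_diff2 IH. Qed.

Lemma eq_boxavg (k k' : I -> nat) s F : {in s, k =1 k'} -> boxavg k s F = boxavg k' s F.
Proof.
elim: s => //= i s IH kk'; rewrite kk' ?mem_head// IH// => j js.
by rewrite kk'// inE js orbT.
Qed.

Lemma boxavg_rem (k : I -> nat) s i F : i \in s ->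
  boxavg k s F = segavg (e i) (k i) (boxavg k (rem i s) F).
Proof.
elim: s => //= j s IH; rewrite inE eq_sym; case: eqVneq => [->//|_] /= /IH ->.
by rewrite segavgC.
Qed.

Definition upd (k : I -> nat) i v : I -> nat := fun j => if j == i then v else k j.

(** Commutation makes direction [i] outermost, where [segavg_darboux] applies to the average over
    the other directions. *)
Lemma boxavg_darboux (k : I -> nat) i F x :
  let A l := boxavg l (enum I) F x in
  let m := 2 * (k i)%:R + 1 in
  (m + 2) * (A (upd k i (k i).+1) - A k) + (m - 2) * (A (upd k i (k i).-1) - A k)
  = m * boxavg k (enum I) (diff2 (e i) F) x.
Proof.
move=> A m.
have Aupd v : A (upd k i v) = segavg (e i) v (boxavg k (rem i (enum I)) F) x.
  rewrite /A (@boxavg_rem _ _ i) ?mem_enum// {1}/upd eqxx; congr segavg.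
  apply: eq_boxavg => j; rewrite mem_rem_uniq ?enum_uniq// !inE => /andP[ji _].
  by rewrite /upd (negbTE ji).
have Ak : A k = segavg (e i) (k i) (boxavg k (rem i (enum I)) F) x.
  by rewrite /A (@boxavg_rem _ _ i) ?mem_enum.
rewrite !Aupd Ak segavg_darboux diff2_boxavg.
by rewrite [in RHS](@boxavg_rem _ _ i) ?mem_enum.
Qed.

End Multi.
End BoxAverages.

(** * One-variable inequalities for the barrier *)

Section Barrier.
Context {R : realType}.

Lemma ln_ge_1Binv (y : R) : 0 < y -> 1 - y^-1 <= ln y.
Proof.
move=> y0; have := @le_ln1Dx R (y^-1 - 1).
rewrite addrCA subrr addr0 lnV ?posrE// => h.
by rewrite -lerN2 opprB h// ltrBDr addNr invr_gt0.
Qed.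

Lemma powR_ge_1Dln (y a : R) : 0 < y -> 1 + a * ln y <= y `^ a.
Proof. by move=> y0; rewrite /powR gt_eqF// expR_ge1Dx. Qed.

(** Using [1 - y^-1 <= ln y] once for each logarithm gives only zero, since the first-order terms
    cancel. Splitting [ln y = ln (y / z) + ln z] at [z = 1 + x / 2], respectively [z = 1 - x / 2],
    keeps the quadratic term. *)
Lemma entropy_ge (x : R) : 0 <= x < 1 ->
  x ^+ 2 / 2 <= (1 + x) * ln (1 + x) + (1 - x) * ln (1 - x).
Proof.
move=> /andP[x0 x1].
have lnD (y z : R) : 0 < y -> 0 < z -> 1 - z / y + (1 - z^-1) <= ln y.
  move=> y0 z0; have -> : ln y = ln (y / z) + ln z.
    by rewrite -lnM ?posrE ?divr_gt0// divfK// gt_eqF.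
  by rewrite -[z / y]invf_div lerD// ln_ge_1Binv// divr_gt0.
have p1 : 0 < 1 + x by lra.
have p2 : 0 < 1 - x by lra.
have p3 : 0 < 1 + x / 2 by lra.
have p4 : 0 < 1 - x / 2 by lra.
have h1 := ler_wpM2l (ltW p1) (lnD _ _ p1 p3).
have h2 := ler_wpM2l (ltW p2) (lnD _ _ p2 p4).
apply: le_trans (lerD h1 h2).
have -> : (1 + x) * (1 - (1 + x / 2) / (1 + x) + (1 - (1 + x / 2)^-1))
    + (1 - x) * (1 - (1 - x / 2) / (1 - x) + (1 - (1 - x / 2)^-1))
  = x ^+ 2 / 2 / (1 - x ^+ 2 / 4).
  by field; rewrite !gt_eqF//; nra.
by rewrite ler_pdivlMr; nra.
Qed.

(** Linearising the power by [1 + a * ln y] reduces this to [entropy_ge]. With [x = 2 / m], the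
    weights [1 + x] and [1 - x] are those of the Darboux operator divided by [m]. *)
Lemma powR_secdiff (x a : R) : 0 <= x < 1 -> 0 <= a ->
  a * x ^+ 2 / 2 <=
  (1 + x) * ((1 + x) `^ a - 1) + (1 - x) * ((1 - x) `^ a - 1).
Proof.
move=> /[dup] /entropy_ge h /andP[x0 x1] a0.
have p1 : 0 < 1 + x by lra.
have p2 : 0 < 1 - x by lra.
have h1 := ler_wpM2l (ltW p1) (powR_ge_1Dln _ a p1).
have h2 := ler_wpM2l (ltW p2) (powR_ge_1Dln _ a p2).
have h3 := ler_wpM2l a0 h.
by move: h1 h2 h3; set A := _ `^ _; set B := (1 - x) `^ _; nra.
Qed.

End Barrier.

(** * Maximum principle in the half-widths of boxes *)

Section DiscreteMeanValue.
Context {R : realType} {V : zmodType} {N : nat}.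
Hypothesis N2 : (2 <= N)%N.

(** The number of lattice points of the box, that is, its volume in cells. *)
Definition boxcard (k : 'I_N -> nat) : R := \prod_i (2 * (k i)%:R + 1).

Let a : R := 2 / N%:R.
Let b k := boxcard k `^ a.
Let m (k : 'I_N -> nat) i : R := 2 * (k i)%:R + 1.

Lemma boxcard_ge1 k : 1 <= boxcard k.
Proof.
by rewrite /boxcard; elim/big_ind: _ => // [x y|i _]; [exact: mulr_ege1|
   rewrite lerDr mulr_ge0].
Qed.

Lemma boxcard_upd k i v :
  boxcard (upd k i v) = boxcard k * ((2 * v%:R + 1) / (2 * (k i)%:R + 1)).
Proof.
have m0 : 2 * (k i)%:R + 1 != 0 :> R by rewrite gt_eqF// ltr_wpDl// mulr_ge0.
rewrite /boxcard (bigD1 i)//= {1}/upd eqxx [in RHS](bigD1 i)//=.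
rewrite (eq_bigr (fun j => 2 * (k j)%:R + 1)); first by field.
by move=> j /negbTE ji; rewrite /upd ji.
Qed.

Lemma boxcard_gt k i : (k i)%:R < boxcard k.
Proof.
rewrite /boxcard (bigD1 i)//= (@lt_le_trans _ _ (2 * (k i)%:R + 1))//.
  by have : 0 <= (k i)%:R :> R by []; lra.
rewrite ler_peMr ?addr_ge0 ?mulr_ge0//.
by elim/big_ind: _ => // [x y|j _]; [exact: mulr_ege1| rewrite lerDr mulr_ge0].
Qed.

(** The [N]-th power of the shortest side is at most the product of all sides. *)
Lemma boxcard_min k : exists i, (2 * (k i)%:R + 1) ^+ 2 <= boxcard k `^ a.
Proof.
have i0 : 'I_N by exists 0%N; lia.
pose i := [arg min_(i < i0) k i]%N; exists i.
have imin j : (k i <= k j)%N by rewrite /i; case: arg_minnP => // i' _ ->.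
have m0 : 0 <= 2 * (k i)%:R + 1 :> R by rewrite addr_ge0 ?mulr_ge0.
have N0 : N%:R != 0 :> R by rewrite pnatr_eq0; lia.
have <- : ((2 * (k i)%:R + 1) ^+ N) `^ a = (2 * (k i)%:R + 1) ^+ 2 :> R.
  by rewrite -!powR_mulrn// -powRrM; congr powR; rewrite /a; field.
rewrite ge0_ler_powR ?nnegrE ?divr_ge0 ?exprn_ge0//.
  by rewrite (le_trans _ (boxcard_ge1 _)).
rewrite -[X in _ ^+ X]card_ord -prodr_const ler_prod// => j _.
by rewrite m0 lerD2r ler_wpM2l// ler_nat.
Qed.

Lemma barrier_pos k i :
  2 * a * b k / m k i ^+ 2 <=
  ((m k i + 2) * (b (upd k i (k i).+1) - b k)
   + (m k i - 2) * (b (upd k i (k i).-1) - b k)) / m k i.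
Proof.
rewrite /m; set w := (2 * _ + 1).
have a0 : 0 <= a by rewrite divr_ge0.
have m1 : 1 <= w by rewrite lerDr mulr_ge0.
have mn0 : w != 0 by rewrite gt_eqF// (lt_le_trans _ m1).
have b0 : 0 <= b k by exact: powR_ge0.
have bu v : b (upd k i v) = b k * ((2 * v%:R + 1) / w) `^ a.
  rewrite /b boxcard_upd powRM// ?divr_ge0 ?addr_ge0 ?mulr_ge0//.
  by rewrite (le_trans _ (boxcard_ge1 _)).
rewrite !bu.
have -> : (2 * (k i).+1%:R + 1) / w = 1 + 2 / w.
  by rewrite -natr1 /w; field.
(* At [k i = 0] the ratio [2 / w] equals 2, outside the range of [powR_secdiff]. The backward
   difference vanishes there, and [ln 3 >= 2 / 3] handles the forward one. *)
case E : (k i) @w m1 mn0 bu => [|j] w m1 mn0 bu.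
  have -> : w = 1 by rewrite /w mulr0 add0r.
  rewrite /= mulr0 add0r !divr1 powR1 mulr1 subrr mulr0 addr0 expr1n divr1.
  have h3 : 1 + 2 = 3 :> R by ring.
  rewrite h3; have h := powR_ge_1Dln 3 a (ltr0Sn _ 2).
  have := ler_wpM2l a0 (ln_ge_1Binv 3 (ltr0Sn R 2)).
  set l := ln _ in h *; set y := 3 `^ a in h *; move=> h4.
  have h5 : 2 * a <= 3 * (y - 1) by lra.
  by have := ler_wpM2l b0 h5; lra.
have -> : (2 * j.+1.-1%:R + 1) / w = 1 - 2 / w.
  have E1 : j.+1%:R = j%:R + 1 :> R by rewrite natr1.
  by move: mn0; rewrite /w /= E1 => mn0; field.
have m3 : 3 <= w by rewrite /w -natr1; have : 0 <= j%:R :> R by []; lra.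
have x01 : 0 <= 2 / w < 1.
  by rewrite divr_ge0//= ?ltr_pdivrMr ?(le_trans _ m1)//; lra.
have := ler_wpM2l b0 (powR_secdiff _ _ x01 a0).
set y := _ `^ a; set z := _ `^ a => h.
have -> : 2 * a * b k / w ^+ 2 = b k * (a * (2 / w) ^+ 2 / 2) by field.
by apply: (le_trans h); rewrite le_eqVlt; apply/orP; left; apply/eqP; field.
Qed.

(** Every direction contributes a nonnegative amount, and the shortest side alone at least
    [2 * a]. *)
Lemma barrier_sum k :
  2 * a <= \sum_i ((m k i + 2) * (b (upd k i (k i).+1) - b k)
                   + (m k i - 2) * (b (upd k i (k i).-1) - b k)) / m k i.
Proof.
have [i Hi] := boxcard_min k.
have a0 : 0 <= a by rewrite divr_ge0.
have m0 j : 0 < m k j by rewrite ltr_wpDl// mulr_ge0.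
apply: (@le_trans _ _ (2 * a * b k / m k i ^+ 2)).
  by rewrite -mulrA ler_peMr ?mulr_ge0// ler_pdivlMr ?mul1r// exprn_gt0.
rewrite (bigD1 i)//= (le_trans (barrier_pos k i))// lerDl sumr_ge0// => j _.
apply: le_trans (barrier_pos k j).
by rewrite divr_ge0 ?exprn_ge0 ?(ltW (m0 _))//; do 2?rewrite mulr_ge0//; exact: powR_ge0.
Qed.

(** Maximise average plus barrier over boxes of volume below [P]. If the maximum exceeded the
    claimed bound, it would dominate all boxes of volume up to [3 * P], hence all neighbours of the
    maximiser, and the Darboux operator would be nonpositive there. *)
Lemma discrete_mean_value (e : 'I_N -> V) (F : V -> R) (x : V) (kappa G P : R) :
  0 < kappa -> 0 < P ->
  (forall y, - kappa <= \sum_i diff2 (e i) F y) ->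
  (forall k, P <= boxcard k -> boxavg e k (enum 'I_N) F x <= G) ->
  F x <= G + kappa / a * (3 * P) `^ a.
Proof.
move=> kappa0 P0 HF HG.
have a0 : 0 < a by rewrite divr_gt0// ltr0n; lia.
(* With this constant the barrier contributes at least [2 * kappa], more than the [kappa] that [F]
   can take away. *)
set c := kappa / a; have c0 : 0 < c by rewrite divr_gt0.
pose k0 (i : 'I_N) := 0%N.
have A0 : boxavg e k0 (enum 'I_N) F x = F x.
  suff -> : boxavg e k0 (enum 'I_N) F = F by [].
  elim: (enum _) => //= i s ->; apply/funext => y.
  by rewrite /segavg /= mulr0 add0r divr1.
have [Pk0|Pk0] := leP P (boxcard k0).
  by rewrite -A0 (le_trans (HG _ Pk0))// lerDl mulr_ge0 ?powR_ge0// ltW.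
pose A k := boxavg e k (enum 'I_N) F x.
pose B k := A k + c * b k.
(* Each half-width is smaller than the volume, so boxes of volume below [P] are coded by a finite
   type. *)
pose n := (Num.truncn P).
have nP k : boxcard k < P -> forall i, (k i < n.+1)%N.
  move=> kP i; rewrite ltnS /n truncn_ge_nat ?(ltW P0)//.
  by rewrite (le_trans _ (ltW kP))// ltW// boxcard_gt.
pose toN (f : {ffun 'I_N -> 'I_n.+1}) : 'I_N -> nat := fun i => f i.
pose f0 : {ffun 'I_N -> 'I_n.+1} := [ffun=> ord0].
have f0P : boxcard (toN f0) < P.
  by rewrite (_ : toN f0 = k0)//; apply/funext => i; rewrite /toN ffunE.
have [f fP fmax] := @Order.TotalTheory.arg_maxP _ R _ f0 (fun f => boxcard (toN f) < P)
   (B \o toN) f0P.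
set ks := toN f in fP.
have Bmax k : boxcard k < P -> B k <= B ks.
  move=> kP; pose g : {ffun 'I_N -> 'I_n.+1} := [ffun i => inord (k i)].
  have gk : toN g = k.
    by apply/funext => i; rewrite /toN ffunE inordK// nP.
  by have := fmax g; rewrite /= gk; apply.
have [Bs|Bs] := leP (B ks) (G + c * (3 * P) `^ a).
  rewrite -A0 (le_trans _ Bs)// (le_trans _ (Bmax _ Pk0))//.
  by rewrite lerDl mulr_ge0 ?powR_ge0// ltW.
(* From volume [P] on, [HG] bounds the average. The factor 3 is the largest growth of the volume
   under one unit of half-width, reached from half-width 0. *)
have Bmax3 k : boxcard k <= 3 * P -> B k <= B ks.
  have [/Bmax//|Pk k3] := ltP (boxcard k) P.
  rewrite (le_trans _ (ltW Bs))// lerD ?HG// ler_wpM2l ?(ltW c0)// ge0_ler_powR//.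
  - exact: ltW.
  - by rewrite nnegrE (le_trans _ (boxcard_ge1 _)).
  - by rewrite nnegrE mulr_ge0// ltW.
have m0 j : 0 < m ks j by rewrite ltr_wpDl// mulr_ge0.
have : \sum_i ((m ks i + 2) * (B (upd ks i (ks i).+1) - B ks)
             + (m ks i - 2) * (B (upd ks i (ks i).-1) - B ks)) / m ks i <= 0.
  apply: sumr_le0 => i _; rewrite pmulr_lle0 ?invr_gt0//.
  have Bu v : (v <= (ks i).+1)%N -> B (upd ks i v) - B ks <= 0.
    move=> vk; rewrite subr_le0 Bmax3// boxcard_upd mulrC ler_pM ?divr_ge0 ?addr_ge0 ?mulr_ge0//.
    - by rewrite (le_trans _ (boxcard_ge1 _)).
    - rewrite ler_pdivrMr//.
      have : v%:R <= (ks i).+1%:R :> R by rewrite ler_nat.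
      by rewrite -natr1; have : 0 <= (ks i)%:R :> R by []; lra.
    - exact: ltW.
  rewrite -[leRHS]addr0 lerD//.
    by rewrite mulr_ge0_le0 ?Bu// addr_ge0// ltW.
  (* The weight [m - 2] is negative only at half-width 0, where [0.-1 = 0] leaves the box
     unchanged. *)
  case E : (ks i) => [|j].
    rewrite (_ : upd ks i _ = ks) ?subrr ?mulr0//.
    by apply/funext => j; rewrite /upd; case: eqP => // ->.
  rewrite mulr_ge0_le0 ?Bu ?E//= ?leqW//.
  by rewrite /m E -natr1; have : 0 <= j%:R :> R by []; lra.
suff : 0 < \sum_i ((m ks i + 2) * (B (upd ks i (ks i).+1) - B ks)
             + (m ks i - 2) * (B (upd ks i (ks i).-1) - B ks)) / m ks i by move=> /lt_geF ->.
rewrite (eq_bigr (fun i => boxavg e ks (enum 'I_N) (diff2 (e i) F) x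
   + c * (((m ks i + 2) * (b (upd ks i (ks i).+1) - b ks)
             + (m ks i - 2) * (b (upd ks i (ks i).-1) - b ks)) / m ks i))); last first.
  move=> i _; have := boxavg_darboux e ks i F x; rewrite -/(m ks i) -/A => Hd.
  have -> : boxavg e ks (enum 'I_N) (diff2 (e i) F) x =
     ((m ks i + 2) * (A (upd ks i (ks i).+1) - A ks)
             + (m ks i - 2) * (A (upd ks i (ks i).-1) - A ks)) / m ks i.
    by rewrite Hd mulrC mulKf// gt_eqF.
  by rewrite /B; field; rewrite gt_eqF.
rewrite big_split/= -mulr_sumr -boxavg_sum.
have := ler_wpM2l (ltW c0) (barrier_sum ks).
have h1 : - kappa <= boxavg e ks (enum 'I_N) (fun y => \sum_j diff2 (e j) F y) x.
  by rewrite -[leLHS](boxavg_cst e ks (enum 'I_N) _ x); exact: le_boxavg.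
have -> : c * (2 * a) = 2 * kappa by rewrite /c; field; rewrite gt_eqF.
by rewrite -/b; set S := \sum_i _ ; lra.
Qed.

End DiscreteMeanValue.

(** * Lower sums for the iterated integral *)

Section IteratedIntegral.
Context {R : realType}.

Lemma iint_ge0 n (f : 'rV[R]_n -> \bar R) :
  (forall x, 0 <= f x)%E -> (0 <= iint f)%E.
Proof.
elim: n f => [|n IH] f f0 /=; first exact: f0.
by apply: integral_ge0 => t _; exact: IH.
Qed.

Lemma iint0 n (f : 'rV[R]_n -> \bar R) : (forall x, f x = 0)%E -> iint f = 0%E.
Proof.
elim: n f => [|n IH] f f0 /=; first exact: f0.
by apply: integral0_eq => t _; exact: IH.
Qed.

(* Only the smaller function has to be measurable, since the integral of a
   nonnegative function is the supremum of those of the simple functions below. *)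
Lemma ge0_le_integral_lower (G F : R -> \bar R) :
  (forall s, 0 <= G s)%E -> (forall s, G s <= F s)%E ->
  (\int[@lebesgue_measure R]_s G s <= \int[@lebesgue_measure R]_s F s)%E.
Proof.
move=> G0 GF.
have F0 s : (0 <= F s)%E by exact: le_trans (GF s).
rewrite !ge0_integralTE//; apply: ereal_sup_le => _ [u /= uG <-].
by exists u => //= s; rewrite (le_trans (uG s)).
Qed.

(** The cells of length [h] starting at the lattice points are disjoint, so the left side is the
    integral of a step function below [F]. *)
Lemma segsum_le_integral (h : R) (k : nat) (c : R -> R) (F : R -> \bar R) (t : R) :
  0 < h -> (forall s, 0 <= c s) -> (forall s, (0 <= F s)%E) ->
  (forall r s : R, r <= s < r + h -> ((c r)%:E <= F s)%E) ->
  ((h * segsum h k c t)%:E <= \int[lebesgue_measure]_s F s)%E.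
Proof.
move=> h0 c0 F0 cF.
pose cell r s : R := c r * \1_(`[r, r + h[%classic) s.
have cell0 r s : 0 <= cell r s by rewrite mulr_ge0.
have cell_out r s : ~~ (r <= s < r + h) -> cell r s = 0.
  by move=> /negbTE rs; rewrite /cell indicE mem_setE in_itv/= rs mulr0.
have cell_le r s : ((cell r s)%:E <= F s)%E.
  have [rs|/cell_out->//] := boolP (r <= s < r + h).
  by rewrite /cell indicE mem_setE in_itv/= rs mulr1 cF.
have cell_int r : (\int[lebesgue_measure]_s (cell r s)%:E = (h * c r)%:E)%E.
  under eq_integral do rewrite EFinM.
  rewrite ge0_integralZl_EFin//; last first.
    by apply/measurable_EFinP; exact: measurable_indic.
  have muE : lebesgue_measure (`[r, r + h[%classic : set R) = h%:E.
    by rewrite lebesgue_measure_itv/= lte_fin ltrDl h0 -EFinD addrAC subrr add0r.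
  by rewrite integral_indic// setIT [X in (_ * X)%E]muE -EFinM mulrC.
have cell_meas r : measurable_fun setT (EFin \o cell r).
  by apply/measurable_EFinP; apply: measurable_funM => //; exact: measurable_indic.
pose G j s := segsum h j (fun r => cell r s) t.
have G0 j s : 0 <= G j s.
  by rewrite /G; elim: j => //= j IH; rewrite !addr_ge0.
have Gmeas j : measurable_fun setT (EFin \o G j).
  elim: j => [|j IH]; first exact: cell_meas.
  rewrite (_ : _ \o _ = (fun s => (EFin \o G j) s + ((cell (t + h *+ j.+1) s)%:E
     + (cell (t - h *+ j.+1) s)%:E))%E); last by apply/funext => s.
  apply: emeasurable_funD => //; apply: emeasurable_funD; exact: cell_meas.
have -> : ((h * segsum h k c t)%:E = \int[lebesgue_measure]_s (G k s)%:E)%E.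
  elim: k => [|k IH]; first by rewrite /= cell_int.
  rewrite /G /= !mulrDr !EFinD IH.
  under [RHS]eq_integral do rewrite !EFinD.
  rewrite ge0_integralD//; first last.
  - apply: emeasurable_funD; exact: cell_meas.
  - by move=> s _; rewrite adde_ge0// lee_fin.
  - exact: Gmeas.
  - by move=> s _; have := G0 k s; rewrite /G -lee_fin.
  rewrite ge0_integralD ?cell_int//.
  - by move=> s _; rewrite lee_fin.
  - exact: cell_meas.
  - by move=> s _; rewrite lee_fin.
  - exact: cell_meas.
apply: ge0_le_integral_lower => s; first by rewrite lee_fin.
(* Carrying the support of the step function through the induction ensures that at most one cell
   contributes at [s]. *)
suff [//] : ((G k s)%:E <= F s)%E /\
    (~~ (t - h *+ k <= s < t + h *+ k.+1) -> G k s = 0).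
elim: k => [|k [IH1 IH2]].
  by split; [exact: cell_le|rewrite mulr0n subr0 mulr1n => /cell_out].
have kh0 : 0 <= h *+ k by rewrite mulrn_wge0// ltW.
have E1 : h *+ k.+1 = h *+ k + h by rewrite mulrSr.
have E2 : h *+ k.+2 = h *+ k + h + h by rewrite !mulrSr.
rewrite /G /= -/(G k s).
have [s1|s1] := boolP (t + h *+ k.+1 <= s < t + h *+ k.+2).
  rewrite IH2 ?add0r; last by move: s1; rewrite E1 E2; lra.
  rewrite [X in _ + X]cell_out ?addr0 ?cell_le//; last by move: s1; rewrite E1 E2; lra.
  by split => //; move: s1; rewrite E1 E2; lra.
have [s2|s2] := boolP (t - h *+ k.+1 <= s < t - h *+ k).
  rewrite IH2 ?add0r; last by move: s2; rewrite E1; lra.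
  rewrite [X in X + _]cell_out ?add0r ?cell_le//; last by move: s2; rewrite E1; lra.
  by split => //; move: s2; rewrite E1 E2; lra.
rewrite [X in _ + (X + _)]cell_out ?add0r; last by move: s1; rewrite E1 E2; lra.
rewrite cell_out ?addr0; last by move: s2; rewrite E1; lra.
split => // s3; apply: IH2; move: s1 s2 s3; rewrite E1 E2; lra.
Qed.

(** The row built inside [iint], whose outermost variable is the first coordinate. *)
Definition consrow {n} (t : R) (v : 'rV[R]_n) : 'rV[R]_n.+1 :=
  \row_k if unlift ord0 k is Some j then v ord0 j else t.

Lemma consrow0 n t (v : 'rV[R]_n) : consrow t v 0 ord0 = t.
Proof. by rewrite mxE unlift_none. Qed.

Lemma consrowS n t (v : 'rV[R]_n) j : consrow t v 0 (lift ord0 j) = v 0 j.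
Proof. by rewrite mxE liftK. Qed.

Lemma eq_consrow n (x : 'rV[R]_n.+1) :
  x = consrow (x 0 ord0) (\row_j x 0 (lift ord0 j)).
Proof.
apply/rowP => i; case: (unliftP ord0 i) => [j|] ->; last by rewrite consrow0.
by rewrite consrowS mxE.
Qed.

Lemma consrowD n s t (v w : 'rV[R]_n) :
  consrow s v + consrow t w = consrow (s + t) (v + w).
Proof.
apply/rowP => i; case: (unliftP ord0 i) => [j|] ->; rewrite mxE.
  by rewrite !consrowS mxE.
by rewrite !consrow0.
Qed.

Lemma evec_consrow0 n (h : R) : h *: evec R (ord0 : 'I_n.+1) = consrow h 0.
Proof.
apply/rowP => i; case: (unliftP ord0 i) => [j|] ->; rewrite !mxE /= ?liftK ?unlift_none.
  by rewrite mxE mulr0.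
by rewrite mulr1.
Qed.

Lemma evec_consrowS n (h : R) (i : 'I_n) :
  h *: evec R (lift ord0 i) = consrow 0 (h *: evec R i).
Proof.
apply/rowP => j; case: (unliftP ord0 j) => [l|] ->; rewrite !mxE /= ?liftK ?unlift_none.
  by rewrite !mxE (inj_eq lift_inj).
by rewrite mulr0.
Qed.

Lemma consrowN n t (v : 'rV[R]_n) : - consrow t v = consrow (- t) (- v).
Proof.
by apply/rowP => j; case: (unliftP ord0 j) => [l|] ->; rewrite !mxE ?liftK ?unlift_none// !mxE.
Qed.

Lemma consrowMn n t (v : 'rV[R]_n) j : consrow t v *+ j = consrow (t *+ j) (v *+ j).
Proof.
elim: j => [|j IH]; last by rewrite !mulrSr IH consrowD.
by apply/rowP => i; case: (unliftP ord0 i) => [l|] ->; rewrite !mxE ?liftK ?unlift_none// !mxE.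
Qed.

(** The slices to which this applies, such as [consrow t], are affine but not additive, so only
    compatibility with steps is asked of [phi]. *)
Lemma segsum_transport (V W : zmodType) (phi : V -> W) d e k (F : W -> R) x :
  (forall y j, phi (y + d *+ j) = phi y + e *+ j) ->
  (forall y j, phi (y - d *+ j) = phi y - e *+ j) ->
  segsum e k F (phi x) = segsum d k (F \o phi) x.
Proof. by move=> h1 h2; elim: k => //= k ->; rewrite h1 h2. Qed.

Lemma boxavg_consrow n (h : R) (k : 'I_n.+1 -> nat) (g : 'rV[R]_n.+1 -> R) t v s :
  boxavg (fun i => h *: evec R i) k (map (lift ord0) s) g (consrow t v)
  = boxavg (fun i => h *: evec R i) (k \o lift ord0) s (g \o consrow t) v.
Proof.
elim: s v => //= i s IH v; rewrite /segavg; congr (_ / _).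
rewrite (@segsum_transport _ _ (consrow t) (h *: evec R i)).
- by congr segsum; apply/funext => w; exact: IH.
- by move=> y j; rewrite evec_consrowS consrowMn consrowD mul0rn addr0.
- by move=> y j; rewrite evec_consrowS consrowMn consrowN consrowD mul0rn oppr0 addr0.
Qed.

(** A lower Riemann sum: [g] at the lower corner of a cell lies below [f] on the cell. The induction
    follows the recursion of [iint], with [segsum_le_integral] in the outermost variable. *)
Lemma boxsum_le_iint n (h : R) (k : 'I_n -> nat) (g : 'rV[R]_n -> R)
    (f : 'rV[R]_n -> \bar R) (x : 'rV[R]_n) :
  0 < h -> (forall y, 0 <= g y) -> (forall y, 0 <= f y)%E ->
  (forall y z : 'rV[R]_n, (forall i, y 0 i <= z 0 i < y 0 i + h) -> ((g y)%:E <= f z)%E) ->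
  ((h ^+ n * boxcard k * boxavg (fun i => h *: evec R i) k (enum 'I_n) g x)%:E <= iint f)%E.
Proof.
move=> h0; elim: n k g f x => [|n IH] k g f x g0 f0 gf.
  rewrite /boxcard big_ord0 expr0 !mul1r /= (_ : enum 'I_0 = [::]); last first.
    by apply: size0nil; rewrite size_enum_ord.
  by apply: gf => -[].
rewrite enum_ordSl /boxcard big_ord_recl -/(boxcard (k \o lift ord0)) exprS.
rewrite [x]eq_consrow; set t := x _ _; set v := \row_ _ _.
(* The lower sum over the slice at first coordinate [r]. *)
pose c r := h ^+ n * boxcard (k \o lift ord0)
  * boxavg (fun i => h *: evec R i) (k \o lift ord0) (enum 'I_n) (g \o consrow r) v.
have m0 : 2 * (k ord0)%:R + 1 != 0 :> R by rewrite gt_eqF// ltr_wpDl// mulr_ge0.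
rewrite [boxavg _ _ _ _ _]/= /segavg.
rewrite (@segsum_transport _ _ (fun r => consrow r v) h); last 2 first.
- by move=> y j; rewrite evec_consrow0 consrowMn consrowD mul0rn addr0.
- by move=> y j; rewrite evec_consrow0 consrowMn consrowN consrowD mul0rn oppr0 addr0.
have -> : h * h ^+ n * ((2 * (k ord0)%:R + 1) * boxcard (k \o lift ord0)) *
  (segsum h (k ord0) ((boxavg (fun i => h *: evec R i) k [seq lift ord0 i | i <- enum 'I_n]  g)
      \o (consrow^~ v)) t / (2 * (k ord0)%:R + 1)) = h * segsum h (k ord0) c t.
  pose d r := boxavg (fun i => h *: evec R i) (k \o lift ord0) (enum 'I_n) (g \o consrow r) v.
  have -> : segsum h (k ord0) c t
      = h ^+ n * boxcard (k \o lift ord0) * segsum h (k ord0) d t.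
    by elim: (k ord0) => //= j ->; rewrite !mulrDr.
  rewrite [X in segsum _ _ X t / _](_ : _ = d); first by field.
  by apply/funext => r /=; rewrite boxavg_consrow.
apply: segsum_le_integral => //.
- move=> r; rewrite mulr_ge0 ?mulr_ge0 ?exprn_ge0 ?(ltW h0)//.
    by rewrite (le_trans _ (boxcard_ge1 _)).
  by rewrite -[leLHS](boxavg_cst (fun i => h *: evec R i) (k \o lift ord0) (enum 'I_n) _ v);
     apply: le_boxavg => y; exact: g0.
- by move=> s; apply: iint_ge0.
- move=> r s rs; apply: IH => [y|y|y z yz]; [exact: g0|exact: f0|].
  apply: gf => i; case: (unliftP ord0 i) => [j|] ->; first by rewrite !consrowS.
  by rewrite !consrow0.
Qed.

End IteratedIntegral.

(** * Second differences of C^{2,beta} functions and the maximum principle *)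

Section Taylor.
Context {R : realType}.

(** The mean value theorem is applied twice: to the symmetrised [phi] on [[0, h]], then to [chi] on
    [[- th, th]]. *)
Lemma secdiff_taylor (g g1 g2 : R -> R) (h c w : R) : 0 < h ->
  (forall t : R, `|t| <= h -> is_derive t 1 g (g1 t)) ->
  (forall t : R, `|t| <= h -> is_derive t 1 g1 (g2 t)) ->
  (forall t, `|t| <= h -> `|g2 t - c| <= w) ->
  `|g h + g (- h) - 2 * g 0 - h ^+ 2 * c| <= 2 * w * h ^+ 2.
Proof.
move=> h0 dg dg1 gw.
have w0 : 0 <= w by apply: le_trans (gw 0 _) => //; rewrite normr0 ltW.
pose phi t := g t + g (- t) - c * t ^+ 2.
pose phi1 t := g1 t - g1 (- t) - 2 * c * t.
have dphi (t : R) : `|t| <= h -> is_derive t 1 phi (phi1 t).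
  move=> th; have dN : is_derive t 1 (fun s : R => - s) (- 1) by exact: is_deriveNid.
  have d1 := dg t th; have d2 : is_derive (- t) 1 g (g1 (- t)).
    by apply: dg; rewrite normrN.
  have d3 : is_derive t 1 (g \o (fun s => - s)) (g1 (- t) * - 1) by exact: is_derive1_comp.
  have -> : phi = g + (g \o (fun s => - s)) - c \*: (fun s => s ^+ 2).
    by apply/funext => s.
  by apply: is_derive_eq; rewrite /phi1 /GRing.scale /=; ring.
have [th th0h E1] : exists2 th, th \in `]0, h[%R & phi h - phi 0 = phi1 th * (h - 0).
  apply: MVT => // [t|].
    by rewrite in_itv/= => /andP[t0 th]; apply: dphi; rewrite ger0_norm ltW.
  apply: derivable_within_continuous => t; rewrite in_itv/= => /andP[t0 th].
  by apply: ex_derive; apply: dphi; rewrite ger0_norm.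
move: th0h; rewrite in_itv/= => /andP[th0 thh].
pose chi t := g1 t - c * t.
have dchi (t : R) : `|t| <= h -> is_derive t 1 chi (g2 t - c).
  move=> /dg1 d1; have -> : chi = g1 - c \*: id by apply/funext => s.
  by apply: is_derive_eq; rewrite /GRing.scale /= mulr1.
have bnd t : - th <= t -> t <= th -> `|t| <= h.
  by move=> t1 t2; rewrite ler_norml; apply/andP; split; lra.
have [xi /andP[xi1 xi2] E2] :
    exists2 xi, xi \in `]- th, th[%R & chi th - chi (- th) = (g2 xi - c) * (th - - th).
  apply: MVT => [|t|]; first by lra.
    by rewrite in_itv/= => /andP[t0 t1]; apply: dchi; apply: bnd; rewrite ltW.
  apply: derivable_within_continuous => t; rewrite in_itv/= => /andP[t0 t1].
  by apply: ex_derive; apply: dchi; exact: bnd.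
have gxi := gw xi (bnd _ (ltW xi1) (ltW xi2)).
have -> : g h + g (- h) - 2 * g 0 - h ^+ 2 * c = (g2 xi - c) * (2 * th * h).
  transitivity (phi h - phi 0); first by rewrite /phi oppr0; ring.
  rewrite E1; transitivity ((chi th - chi (- th)) * h); last by rewrite E2; ring.
  by rewrite /phi1 /chi; ring.
rewrite normrM [X in _ * X]ger0_norm; last by rewrite !mulr_ge0 ?ltW.
have -> : 2 * w * h ^+ 2 = w * (2 * h * h) by ring.
apply: ler_pM => //; first by rewrite !mulr_ge0 ?ltW.
by rewrite ler_wpM2r ?(ltW h0)// ler_wpM2l// ltW.
Qed.

Context {N : nat}.
Implicit Types (Omega : set 'rV[R]_N) (x y : 'rV[R]_N) (f : 'rV[R]_N -> R).

Lemma is_derive_line f x v (t : R) : derivable f (x + t *: v) v ->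
  is_derive t 1 (fun s : R => f (x + s *: v)) ('D_v f (x + t *: v)).
Proof.
move=> df; have E : (fun h : R => h^-1 *: (((fun s => f (x + s *: v)) \o shift t) (h *: 1)
      - f (x + t *: v))) =
    (fun h => h^-1 *: ((f \o shift (x + t *: v)) (h *: v) - f (x + t *: v))).
  apply/funext => h /=; congr (_ *: (f _ - _)).
  by rewrite [h%:A]mulr1 scalerDl addrCA.
by split; rewrite /derivable /derive E.
Qed.

Lemma norm_evec_le (i : 'I_N) : `|evec R i| <= 1.
Proof.
rewrite [leLHS]/Num.norm/= mx_normrE; apply/bigmax_leP; split => // -[j k] _ /=.
by rewrite mxE; case: (_ && _); rewrite ?normr1// normr0.
Qed.

Lemma norm_scale_evec (i : 'I_N) (t : R) : `|t *: evec R i| <= `|t|.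
Proof. by rewrite normrZ ler_piMr// norm_evec_le. Qed.

Lemma le_powR_small (C b w : R) : 0 < b -> 0 < w ->
  exists2 r : R, 0 < r & forall t, 0 <= t -> t <= r -> C * t `^ b <= w.
Proof.
move=> b0 w0; pose C' := `|C| + 1; have C0 : 0 < C' by rewrite ltr_wpDl.
exists ((w / C') `^ b^-1); first by rewrite powR_gt0// divr_gt0.
move=> t t0 tr; apply: (@le_trans _ _ (C' * t `^ b)).
  by rewrite ler_wpM2r ?powR_ge0// (le_trans (ler_norm C))// lerDl.
rewrite mulrC -ler_pdivlMr//.
have -> : w / C' = ((w / C') `^ b^-1) `^ b.
  by rewrite -powRrM mulVf ?gt_eqF// powRr1// divr_ge0 ?ltW.
by apply: ge0_ler_powR => //; rewrite ?nnegrE ?powR_ge0// ltW.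
Qed.

Lemma holder_unif_cont {Omega} {beta} f : 0 < beta -> holder_on Omega beta f ->
  forall w, 0 < w -> exists2 r : R, 0 < r & forall x y, Omega x -> Omega y ->
    `|x - y| <= r -> `|f x - f y| <= w.
Proof.
move=> b0 [C HC] w w0; have [r r0 Hr] := le_powR_small C _ _ b0 w0.
by exists r => // x y Ox Oy xy; rewrite (le_trans (HC _ _ Ox Oy))// Hr.
Qed.

(** Hölder continuity of the pure second derivatives makes the error of [secdiff_taylor] uniform in
    [x]. *)
Lemma secdiff_laplacian Omega beta f : 0 < beta -> C2beta Omega beta f ->
  forall w, 0 < w -> exists2 r : R, 0 < r & forall h x, 0 < h -> h <= r ->
    (forall y, `|y - x| <= h -> Omega y) ->
    `|\sum_i diff2 (h *: evec R i) f x - h ^+ 2 * laplacian f x| <= w * h ^+ 2.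
Proof.
move=> b0 [df _ _ d2f] w w0.
(* The 2 is the constant of [secdiff_taylor]; [N + 1] shares the error among the coordinates and is
   positive even for [N = 0]. *)
pose w' := w / (2 * (N%:R + 1)).
have w'0 : 0 < w' by rewrite divr_gt0// mulr_gt0// ltr_wpDl.
have Hi i := holder_unif_cont (pd i (pd i f)) b0 (d2f i i).2 w' w'0.
pose r i := projT1 (cid2 (Hi i)).
have r0 i : 0 < r i by rewrite /r; case: cid2.
have Hr i x y : Omega x -> Omega y -> `|x - y| <= r i ->
    `|pd i (pd i f) x - pd i (pd i f) y| <= w'.
  by rewrite /r; case: cid2 => s s0 /= Hs; exact: Hs.
exists (\big[Num.min/1]_i r i).
  by apply/bigmin_gtP; split => // i _; exact: r0.
move=> h x h0 hr Oh.
have Ox : Omega x by apply: Oh; rewrite subrr normr0 ltW.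
rewrite /laplacian mulr_sumr -sumrB (le_trans (ler_norm_sum _ _ _))//.
apply: (@le_trans _ _ (\sum_(i < N) 2 * w' * h ^+ 2)).
  apply: ler_sum => i _.
  have Ot t : `|t| <= h -> Omega (x + t *: evec R i).
    by move=> th; apply: Oh; rewrite addrAC subrr add0r (le_trans (norm_scale_evec _ _)).
  have := @secdiff_taylor (fun s => f (x + s *: evec R i))
    (fun s => pd i f (x + s *: evec R i)) (fun s => pd i (pd i f) (x + s *: evec R i))
    h (pd i (pd i f) x) w' h0.
  rewrite /= scaleNr scale0r addr0 /diff2; apply => t th.
  - by apply: is_derive_line; exact: (df _ (Ot _ th) i).1.
  - by apply: is_derive_line; exact: ((df _ (Ot _ th) i).2 i).
  - apply: Hr => //; first exact: Ot.
    rewrite addrAC subrr add0r (le_trans (norm_scale_evec _ _))// (le_trans th)//.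
    by rewrite (le_trans hr)// bigmin_le_cond.
rewrite sumr_const card_ord -[leLHS]mulr_natr.
have -> : 2 * w' * h ^+ 2 * N%:R = w * h ^+ 2 * (N%:R / (N%:R + 1)).
  by rewrite /w'; field; rewrite gt_eqF// ltr_wpDl.
rewrite ler_piMr//; first by rewrite mulr_ge0 ?exprn_ge0 ?ltW.
by rewrite ler_pdivrMr ?ltr_wpDl// mul1r lerDl.
Qed.

End Taylor.

(** * Compactness of the closure and comparison with a quadratic *)

Section Domain.
Context {R : realType} {N : nat}.
Implicit Types (Omega : set 'rV[R]_N) (x y : 'rV[R]_N) (f : 'rV[R]_N -> R).

Lemma bounded_set_le (Omega : set 'rV[R]_N) : bounded_set Omega ->
  exists2 D : R, 0 < D & forall x, closure Omega x -> `|x| <= D.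
Proof.
(* One unit puts the bound strictly above [M], the other pays for approximating a point of the
   closure from [Omega]. *)
move=> [M [Mr HM]]; pose D := Num.max M 0 + 2; exists D.
  by rewrite ltr_wpDl// le_max lexx orbT.
move=> x /(_ (ball x 1) (nbhsx_ballx x 1 ltr01)) [y [Oy]].
rewrite -ball_normE /= => xy.
have yM : `|y| <= Num.max M 0 + 1.
  by apply: HM => //; rewrite ltr_pwDr// le_max lexx.
have := ler_normD (x - y) y; rewrite subrK => h.
by rewrite (le_trans h)// /D; move: xy yM; lra.
Qed.

Lemma compact_closure (Omega : set 'rV[R]_N) : bounded_set Omega -> compact (closure Omega).
Proof.
move=> /bounded_set_le[D D0 HD]; apply: bounded_closed_compact; last exact: closed_closure.
by exists D; split => [|M DM x /HD h]; [exact: num_real|exact: le_trans h (ltW DM)].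
Qed.

Lemma coord_le_norm x i : `|x 0 i| <= `|x|.
Proof.
by rewrite [leRHS]/Num.norm/= mx_normrE; apply: (le_bigmax _ (fun ij => `|x ij.1 ij.2|) (0, i)).
Qed.

(** Near a boundary point [f] is negative and the claim is void; near an interior point a ball fits.
    Compactness of the closure makes the radius uniform. *)
Lemma dist_bdry Omega f : open Omega -> bounded_set Omega ->
  {within closure Omega, continuous f} -> (forall x, bdry Omega x -> f x < 0) ->
  exists2 r : R, 0 < r & forall x y, Omega x -> 0 <= f x -> `|y - x| <= r -> Omega y.
Proof.
move=> oO bO cf fb.
have /compact_near_coveringP/(_ R (0^'+) (fun r x => Omega x -> 0 <= f x ->
   forall y, `|y - x| <= r -> Omega y) _) H := compact_closure _ bO.
have {}H : \forall r \near 0^'+, closure Omega `<=` (fun x => Omega x -> 0 <= f x ->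
   forall y, `|y - x| <= r -> Omega y).
  apply: H => x clx; have [Ox|nOx] := pselect (Omega x).
    have /nbhs_ballP[e /= e0 He] : nbhs x Omega by exact: open_nbhs_nbhs.
    exists (ball x (e / 2), [set r | r <= e / 2]) => /=.
      split; first by apply: nbhsx_ballx; rewrite divr_gt0.
      by apply: nbhs_right_le; rewrite divr_gt0.
    move=> [z r] [/= xz re] _ _ y yz; apply: He; move: xz; rewrite -!ball_normE /= => xz.
    have := ler_normD (x - z) (z - y); rewrite addrA subrK => h.
    by rewrite (le_lt_trans h)//; move: yz re; rewrite distrC; lra.
  have fx : f x < 0 by apply: fb.
  have := cf x; rewrite /continuous_at /= => /(_ [set s | s < 0]) h.
  have /h : nbhs (f x) [set s : R | s < 0] by exact: lt_nbhsl.
  rewrite /= /nbhs/= -nbhs_subspace_in// => h1.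
  exists ([set z | closure Omega z -> f z < 0], setT) => /=.
    by split; [exact: h1 | exact: filterT].
  move=> [z r] [/= fz _] Oz; rewrite leNgt fz//.
  exact: subset_closure.
near (0 : R)^'+ => r; exists r => // x y Ox fx yx.
have Hr : closure Omega `<=` (fun x => Omega x -> 0 <= f x ->
   forall y, `|y - x| <= r -> Omega y) by near: r.
by apply: (Hr x) => //; exact: subset_closure.
Unshelve. all: by end_near. Qed.

Lemma diff2_sqr_coord (h : R) i j x :
  diff2 (h *: evec R i) (fun y => (y 0 j) ^+ 2) x = (i == j)%:R * 2 * h ^+ 2.
Proof.
rewrite /diff2 !mxE /= [j == i]eq_sym; case: eqP => _ /=; rewrite ?mulr1 ?mulr0; ring.
Qed.

(** Adding a quadratic in one coordinate makes the Laplacian at least 1, which rules out an interior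
    maximum. On the boundary only the quadratic remains. *)
Lemma sup_le_laplacian Omega beta f (D K : R) : (0 < N)%N ->
  open Omega -> bounded_set Omega ->
  0 < beta -> C2beta_closure Omega beta f -> 0 <= K ->
  (forall x, closure Omega x -> `|x| <= D) ->
  (forall x, Omega x -> - laplacian f x <= K) -> (forall x, bdry Omega x -> f x = 0) ->
  forall x, Omega x -> f x <= (K + 1) * D ^+ 2 / 2.
Proof.
move=> N0 oO bO b0 [C2 cf] K0 HD fK fb x0 Ox0.
pose i0 : 'I_N := Ordinal N0.
pose v y := f y + (K + 1) / 2 * (y 0 i0) ^+ 2.
have cv : {within closure Omega, continuous v}.
  move=> y; apply: cvgD; first exact: cf.
  apply: cvgM; first exact: cvg_cst.
  suff : {within closure Omega, continuous (fun z : 'rV[R]_N => z 0 i0 ^+ 2)} by apply.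
  apply: continuous_subspaceT => z.
  exact: (continuous_comp (@coord_continuous R 1 N 0 i0 z) (@exprn_continuous R 2 _)).
have [c cO cmax] : exists2 c, c \in closure Omega & forall t, t \in closure Omega -> v t <= v c.
  apply: EVT_max_rV => //; [|exact: compact_closure].
  by exists x0; exact: subset_closure.
have {}cmax t : closure Omega t -> v t <= v c by move=> ht; apply: cmax; rewrite inE.
rewrite inE in cO.
have K2 : 0 <= (K + 1) / 2 by rewrite divr_ge0// addr_ge0.
have fv : f x0 <= v c.
  apply: (@le_trans _ _ (v x0)); last exact/cmax/subset_closure.
  by rewrite lerDl mulr_ge0// sqr_ge0.
have sqD : (c 0 i0) ^+ 2 <= D ^+ 2.
  rewrite -real_normK ?num_real// lerXn2r ?nnegrE//; last first.
    by rewrite (le_trans (coord_le_norm _ _))// HD.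
  by rewrite (le_trans _ (HD _ cO)).
have [Oc|nOc] := pselect (Omega c); last first.
  rewrite (le_trans fv)// /v fb// add0r.
  have -> : (K + 1) * D ^+ 2 / 2 = (K + 1) / 2 * D ^+ 2 by ring.
  by rewrite ler_wpM2l.
have /nbhs_ballP[e /= e0 He] : nbhs c Omega by exact: open_nbhs_nbhs.
(* An error of [1 / 2] is below the lower bound 1 of the Laplacian of [v], so the summed second
   differences of [v] would be positive at [c]. *)
have [r r0 Hr] := secdiff_laplacian _ _ _ b0 C2 2^-1 ltac:(by rewrite invr_gt0).
pose h := Num.min r (e / 2).
have h0 : 0 < h by rewrite lt_min r0 divr_gt0.
have he : h <= e / 2 by rewrite ge_min lexx orbT.
have Oh y : `|y - c| <= h -> Omega y.
  by move=> yc; apply: He; rewrite -ball_normE /= distrC (le_lt_trans yc)//; lra.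
have hr : h <= r by rewrite ge_min lexx.
have := Hr h c h0 hr Oh; rewrite ler_norml => /andP[H _].
have sv : \sum_i diff2 (h *: evec R i) v c <= 0.
  apply: sumr_le0 => i _; rewrite /diff2.
  have h1 : v (c + h *: evec R i) <= v c.
    apply/cmax/subset_closure/Oh.
    by rewrite addrAC subrr add0r (le_trans (norm_scale_evec _ _))// ger0_norm// ltW.
  have h2 : v (c - h *: evec R i) <= v c.
    apply/cmax/subset_closure/Oh.
    by rewrite addrAC subrr add0r normrN (le_trans (norm_scale_evec _ _))// ger0_norm// ltW.
  by move: h1 h2; lra.
have svE : \sum_i diff2 (h *: evec R i) v c
    = \sum_i diff2 (h *: evec R i) f c + (K + 1) * h ^+ 2.
  transitivity (\sum_i (diff2 (h *: evec R i) f c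
      + (K + 1) / 2 * diff2 (h *: evec R i) (fun y => (y 0 i0) ^+ 2) c)).
    by apply: eq_bigr => i _; rewrite /diff2 /v; ring.
  rewrite big_split/=; congr (_ + _); rewrite (bigD1 i0)//= big1 ?addr0.
    by rewrite diff2_sqr_coord eqxx /=; field.
  by move=> i /negbTE ii0; rewrite diff2_sqr_coord ii0 !mul0r mulr0.
have hh : 0 < h ^+ 2 by rewrite exprn_gt0.
have := ler_wpM2r (ltW hh) (fK _ Oc); rewrite svE in sv.
move: sv H; set S := \sum_i _; set L := laplacian f c; nra.
Qed.

End Domain.

(** * Absorption by the subcritical exponent *)

Section Growth.
Context {R : realType}.

(* The mean value inequality at scale [rho], with [rho] chosen so that the
   error term absorbs a fixed part of [M]; [p < N / (N - 2)] makes the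
   remaining exponent of [M] positive. *)
Lemma subcritical_bound (N : nat) (p L : R) : (3 <= N)%N -> 1 <= p ->
  p < N%:R / (N%:R - 2) -> 0 < L ->
  exists2 C : R, 0 < C & forall M, 0 < M ->
   (forall rho, 0 < rho -> M / 2 <= M / 8 + (M / 8) `^ (1 - p) / rho
     + N%:R * L * M `^ p * (3 * rho) `^ (2 / N%:R)) -> M <= C.
Proof.
move=> N3 p1 pN L0.
have nN : 3 <= N%:R :> R by rewrite (ler_nat _ 3).
have n0 : 0 < N%:R :> R by lra.
pose q : R := N%:R / 2.
have q0 : 0 < q by rewrite divr_gt0.
(* The final exponent of [M], positive exactly when [p < N / (N - 2)]. *)
pose th := p + (1 - p) * q.
have th0 : 0 < th.
  by move: pN; rewrite ltr_pdivlMr ?subr_gt0 /th /q; [nra|lra].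
have B0 : 0 < 8 * N%:R * L by rewrite !mulr_gt0.
(* Here 12 is 4 times 3: the 4 from the [M / 4] left after absorption, the 3 from [rho]. *)
pose C0 := 12 * 8 `^ (p - 1) * (8 * N%:R * L) `^ q.
have C00 : 0 < C0 by rewrite !mulr_gt0// powR_gt0.
exists (C0 `^ th^-1); first exact: powR_gt0.
move=> M M0 HM.
have Mp x : 0 < M `^ x by exact: powR_gt0.
have MD x y : M `^ (x + y) = M `^ x * M `^ y by rewrite powRD// (gt_eqF M0) implybT.
have M1 : M `^ 1 = M by rewrite powRr1// ltW.
(* The intended value of [3 * rho] to the power [2 / N], making the last error term equal to
   [M / 8]. *)
pose X := M `^ (1 - p) / (8 * N%:R * L).
have X0 : 0 < X by rewrite divr_gt0.
pose rho := X `^ q / 3.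
have rho0 : 0 < rho by rewrite divr_gt0// powR_gt0.
have := HM rho rho0.
have -> : (3 * rho) `^ (2 / N%:R) = X.
  rewrite /rho mulrC divfK// -powRrM /q.
  have -> : N%:R / 2 * (2 / N%:R) = 1 :> R by field; rewrite gt_eqF.
  by rewrite powRr1// ltW.
have -> : N%:R * L * M `^ p * X = M / 8.
  have : M `^ p * M `^ (1 - p) = M.
    by rewrite -MD -[RHS]M1; congr powR; ring.
  by rewrite /X => E; rewrite -[in RHS]E; field; rewrite !gt_eqF.
have -> : (M / 8) `^ (1 - p) = M `^ (1 - p) * 8 `^ (p - 1).
  rewrite powRM ?ltW ?invr_ge0//; congr (_ * _).
  by rewrite -powR_inv1// -powRrM; congr powR; ring.
move=> H.
have {H} : M / 4 * rho <= M `^ (1 - p) * 8 `^ (p - 1).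
  by rewrite -ler_pdivlMr//; lra.
have -> : rho = M `^ ((1 - p) * q) / (8 * N%:R * L) `^ q / 3.
  congr (_ / _); apply: (canRL (mulfK _)); first by rewrite gt_eqF// powR_gt0.
  by rewrite -powRM ?(ltW X0) ?(ltW B0)// /X divfK ?gt_eqF// -powRrM.
have ME : M = M `^ (1 - p) * M `^ p.
  by rewrite -MD -[LHS]M1; congr powR; ring.
rewrite {1}ME => H.
have Bq : 0 < (8 * N%:R * L) `^ q by exact: powR_gt0.
have {H} H : M `^ th <= C0.
  rewrite /th MD /C0.
  rewrite -ler_pdivrMr// -(ler_pM2l (Mp (1 - p))).
  rewrite -(ler_pM2r (_ : 0 < 12^-1))//.
  move: H; set a := M `^ (1 - p); set b := M `^ p; set c := M `^ ((1 - p) * q).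
  set d := _ `^ q; set e := 8 `^ _.
  have -> : a * b / 4 * (c / d / 3) = a * (b * c / d) / 12 by field; rewrite gt_eqF.
  by have -> : a * (12 * e) / 12 = a * e by field.
have -> : M = (M `^ th) `^ th^-1 by rewrite -powRrM divff ?gt_eqF// powRr1// ltW.
by apply: ge0_ler_powR => //; rewrite ?nnegrE ?invr_ge0 ?powR_ge0// ltW.
Qed.

End Growth.

(** * A priori bounds for solutions *)

Section Solution.
Context {R : realType} {N : nat} {p beta : R} {Omega : set 'rV[R]_N}.
Hypotheses (N3 : (3 <= N)%N) (p1 : 1 <= p) (pN : p < N%:R / (N%:R - 2)).
Hypotheses (b0 : 0 < beta) (oO : open Omega) (bO : bounded_set Omega).

(** Plays the role of Jensen's inequality in passing from averages of a power to averages of the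
    function. The form [1 * t] fits [boxavg_lin]. *)
Lemma powR_truncation (t x : R) : 0 < t -> 0 <= x -> x <= 1 * t + t `^ (1 - p) * x `^ p.
Proof.
move=> t0 x0; rewrite mul1r; have [xt|tx] := leP x t.
  by rewrite (le_trans xt)// lerDl mulr_ge0 ?powR_ge0.
have x0' : 0 < x by exact: lt_trans tx.
apply: (@le_trans _ _ (t `^ (1 - p) * x `^ p)); last by rewrite lerDr ltW.
have -> : x `^ p = x `^ (p - 1) * x.
  by rewrite -{3}[x]powRr1 ?(ltW x0')// -powRD ?subrK// (gt_eqF x0') implybT.
rewrite mulrA ler_peMl//.
have -> : t `^ (1 - p) = (t `^ (p - 1))^-1 by rewrite -powRN opprB.
rewrite mulrC ler_pdivlMr ?powR_gt0// mul1r ge0_ler_powR ?nnegrE ?(ltW t0) ?(ltW tx)//.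
by rewrite subr_ge0.
Qed.

(** [discrete_mean_value] is applied to a truncation of [u] extended by zero, on a mesh [h] that
    depends on the solution but cancels from the conclusion. *)
Lemma scale_inequality (L lam alpha : R) (psi : 'rV[R]_N -> R) (M : R) x0 :
  0 < lam -> lam <= L -> alpha < 0 -> solves_P Omega beta p lam alpha psi ->
  0 < M -> (forall x, Omega x -> alpha + lam * psi x <= M) ->
  Omega x0 -> 3 / 4 * M <= alpha + lam * psi x0 ->
  forall rho, 0 < rho -> M / 2 <= M / 8 + (M / 8) `^ (1 - p) / rho
     + N%:R * L * M `^ p * (3 * rho) `^ (2 / N%:R).
Proof.
move=> lam0 lamL alpha0 [[C2 cpsi] eqn bd0 int1] M0 uM Ox0 ux0 rho rho0.
pose u x := alpha + lam * psi x.
have L0 : 0 < L by exact: lt_le_trans lamL.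
have Mp0 : 0 < M `^ p by exact: powR_gt0.
have cu : {within closure Omega, continuous u}.
  move=> y; apply: cvgD; first exact: cvg_cst.
  by apply: cvgM; [exact: cvg_cst|exact: cpsi].
have ub x : bdry Omega x -> u x < 0 by move=> /bd0 px; rewrite /u px mulr0 addr0.
have [r1 r10 Hr1] := dist_bdry _ _ oO bO cu ub.
have eps0 : 0 < M / 4 by rewrite divr_gt0.
have [_ [_ hpsi] _ _] := C2.
have [r2 r20 Hr2] := holder_unif_cont _ b0 hpsi (M / 4 / lam) (divr_gt0 eps0 lam0).
have [r3 r30 Hr3] := secdiff_laplacian _ _ _ b0 C2 _ Mp0.
(* Steps of this size from points with [u >= 0] stay in [Omega], lower [u] by at most [M / 4], and
   give a controlled second-difference error. *)
pose h := Num.min r1 (Num.min r2 r3).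
have h0 : 0 < h by rewrite !lt_min r10 r20.
have hr1 : h <= r1 by rewrite ge_min lexx.
have hr2 : h <= r2 by rewrite !ge_min lexx orbT.
have hr3 : h <= r3 by rewrite !ge_min lexx !orbT.
have uO x y : Omega x -> 0 <= u x -> `|y - x| <= h -> Omega y.
  by move=> Ox ux yx; apply: (Hr1 x) => //; exact: le_trans hr1.
have uu x y : Omega x -> Omega y -> `|x - y| <= h -> u x - M / 4 <= u y.
  move=> Ox Oy xy; have := Hr2 x y Ox Oy (le_trans xy hr2).
  rewrite ler_norml => /andP[_ H]; have := ler_wpM2l (ltW lam0) H.
  by rewrite [lam * (_ / _)]mulrC divfK ?gt_eqF// /u; lra.
(* Truncating at [M / 4] rather than 0 absorbs the oscillation over a cell: [v] at a lower corner is
   at most [u] on the cell. Still [v x0 >= M / 2]. *)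
pose v x : R := \1_Omega x * Num.max (u x - M / 4) 0.
have v0 x : 0 <= v x by rewrite mulr_ge0// le_max lexx orbT.
have vO x : Omega x -> v x = Num.max (u x - M / 4) 0.
  by move=> Ox; rewrite /v indicE mem_set// mul1r.
have vpos x : 0 < v x -> Omega x /\ v x = u x - M / 4.
  have [Ox|nOx] := pselect (Omega x); last by rewrite /v indicE memNset// mul0r ltxx.
  rewrite (vO _ Ox); case: (leP (u x - M / 4) 0) => [|h1 _]; first by rewrite ltxx.
  by [].
(* One copy of [L * M ^ p] bounds the Laplacian term, the other the discretisation error. *)
pose kappa := h ^+ 2 * (2 * L * M `^ p).
have kappa0 : 0 < kappa by rewrite mulr_gt0 ?exprn_gt0// !mulr_gt0.
have lapv y : - kappa <= \sum_i diff2 (h *: evec R i) v y.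
  (* Where [v] vanishes it is minimal, so its second differences are nonnegative. *)
  have := v0 y; rewrite le_eqVlt => /predU1P[vy|/vpos[Oy vy]].
    apply: (@le_trans _ _ 0); first by rewrite oppr_le0 ltW.
    by apply: sumr_ge0 => i _; rewrite /diff2 -vy mulr0 subr0 addr_ge0.
  have uy : 0 <= u y by have := v0 y; rewrite vy; lra.
  have Oh z : `|z - y| <= h -> Omega z by exact: uO.
  have := Hr3 h y h0 hr3 Oh; rewrite ler_norml => /andP[H _].
  have H2 : laplacian psi y = - posp (u y) p by rewrite -eqn// opprK.
  have H3 : posp (u y) p <= M `^ p.
    by rewrite /posp max_l// ge0_ler_powR ?nnegrE ?(ltW M0) ?uM// (le_trans _ p1).
  have h2 : 0 < h ^+ 2 by rewrite exprn_gt0.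
  apply: (@le_trans _ _ (lam * \sum_i diff2 (h *: evec R i) psi y)).
    have H4 := ler_wpM2l (ltW lam0) H.
    have H5 : lam * (h ^+ 2 * (posp (u y) p + M `^ p)) <= L * (h ^+ 2 * (2 * M `^ p)).
      apply: ler_pM => //; first exact: ltW.
      - by rewrite mulr_ge0 ?(ltW h2)// addr_ge0 ?powR_ge0.
      - by rewrite ler_wpM2l ?(ltW h2)//; lra.
    move: H4 H5; rewrite H2 /kappa; set S := \sum_i _; lra.
  rewrite mulr_sumr; apply: ler_sum => i _.
  have e1 z : `|z - y| <= h -> u z - M / 4 <= v z.
    by move=> /Oh Oz; rewrite vO// le_max lexx.
  have ev : `|h *: evec R i| <= h.
    by rewrite (le_trans (norm_scale_evec _ _))// ger0_norm// ltW.
  have := e1 (y + h *: evec R i); rewrite addrAC subrr add0r => /(_ ev).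
  have := e1 (y - h *: evec R i); rewrite addrAC subrr add0r normrN => /(_ ev).
  by rewrite /diff2 vy /u; lra.
have vp_int k : (h ^+ N * boxcard k
    * boxavg (fun i => h *: evec R i) k (enum 'I_N) (fun y => v y `^ p) x0 <= 1).
  rewrite -lee_fin -int1; apply: boxsum_le_iint => //.
  - by move=> y; exact: powR_ge0.
  - by move=> y; rewrite lee_fin mulr_ge0// powR_ge0.
  - move=> y z yz; rewrite lee_fin.
    have := v0 y; rewrite le_eqVlt => /predU1P[vy|vy0].
      by rewrite -vy powR0 ?mulr_ge0 ?powR_ge0// gt_eqF// (lt_le_trans _ p1).
    have [Oy vy] := vpos y vy0.
    have zy : `|z - y| <= h.
      rewrite [leLHS]/Num.norm/= mx_normrE; apply/bigmax_leP; split; first exact: ltW.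
      move=> -[j i] _ /=; rewrite !mxE ler_norml ord1; have := yz i; lra.
    have Oz : Omega z by apply: (uO y) => //; move: vy0; rewrite vy; lra.
    have uz : v y <= u z by rewrite vy uu// distrC.
    rewrite indicE mem_set// mul1r /posp -/(u z) max_l; last exact: le_trans (ltW vy0) uz.
    by rewrite ge0_ler_powR ?nnegrE ?(le_trans _ uz)// (le_trans _ p1).
pose t := M / 8; have t0 : 0 < t by rewrite divr_gt0.
have hN : 0 < h ^+ N by rewrite exprn_gt0.
(* Boxes of at least [P] cells are those of volume at least [rho]. *)
pose P := rho / h ^+ N.
have P0 : 0 < P by rewrite divr_gt0.
have avg_le k : P <= boxcard k ->
    boxavg (fun i => h *: evec R i) k (enum 'I_N) v x0 <= t + t `^ (1 - p) / rho.
  move=> Pk; apply: (@le_trans _ _ (1 * boxavg (fun i => h *: evec R i) k (enum 'I_N) (fun=> t) x0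
     + t `^ (1 - p) * boxavg (fun i => h *: evec R i) k (enum 'I_N) (fun y => v y `^ p) x0)).
    by rewrite -boxavg_lin; apply: le_boxavg => y; exact: powR_truncation.
  rewrite boxavg_cst mul1r lerD2l ler_wpM2l ?powR_ge0//.
  have bk : 0 < boxcard k :> R by rewrite (lt_le_trans _ (boxcard_ge1 _)).
  apply: (@le_trans _ _ ((h ^+ N * boxcard k)^-1)).
    by rewrite -[leRHS]mul1r ler_pdivlMr ?mulr_gt0// mulrC.
  rewrite lef_pV2 ?posrE ?mulr_gt0//.
  by move: Pk; rewrite /P ler_pdivrMr// mulrC.
have N2 : (2 <= N)%N by exact: ltnW.
have := discrete_mean_value N2 _ _ _ _ _ _ kappa0 P0 lapv avg_le.
have n0 : 0 < N%:R :> R by rewrite ltr0n; exact: (ltnW N2).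
(* The factor [h ^ 2] in [kappa] cancels the [h ^ (- 2)] coming from the power of [P]. *)
have -> : kappa / (2 / N%:R) * (3 * P) `^ (2 / N%:R)
    = N%:R * L * M `^ p * (3 * rho) `^ (2 / N%:R).
  have -> : 3 * rho = (3 * P) * h ^+ N by rewrite /P; field; rewrite gt_eqF.
  rewrite [in RHS]powRM ?(ltW hN)//; last by rewrite mulr_ge0// ltW.
  have -> : (h ^+ N) `^ (2 / N%:R) = h ^+ 2.
    rewrite -powR_mulrn ?(ltW h0)// -powRrM mulrC divfK ?gt_eqF//.
    by rewrite powR_mulrn// ltW.
  by rewrite /kappa; field; rewrite gt_eqF.
have : M / 2 <= v x0.
  by rewrite vO// le_max; apply/orP; left; rewrite /u; lra.
by rewrite /t; lra.
Qed.

Lemma exists_plasma (lam alpha : R) (psi : 'rV[R]_N -> R) :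
  solves_P Omega beta p lam alpha psi -> exists2 x, Omega x & 0 < alpha + lam * psi x.
Proof.
move=> [_ _ _ int1]; apply: contrapT => H; move: int1; rewrite iint0.
  by move=> /eqP; rewrite eqe eq_sym oner_eq0.
move=> x; have [Ox|nOx] := pselect (Omega x); last by rewrite indicE memNset// mul0r.
have ux : alpha + lam * psi x <= 0.
  by rewrite leNgt; apply/negP => ux; apply: H; exists x.
by rewrite /posp max_r// powR0 ?mulr0// gt_eqF// (lt_le_trans _ p1).
Qed.

Lemma alpha_bound (L : R) : 0 < L -> exists C : R, forall lam alpha psi,
  0 < lam -> lam <= L -> alpha < 0 -> solves_P Omega beta p lam alpha psi -> - alpha <= C.
Proof.
move=> L0; have [C C0 HC] := subcritical_bound _ _ _ N3 p1 pN L0.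
have [D D0 HD] := bounded_set_le _ bO.
exists (L * ((C `^ p + 1) * D ^+ 2 / 2)) => lam alpha psi lam0 lamL alpha0 sol.
have [x1 Ox1 ux1] := exists_plasma _ _ _ sol.
have [[C2 cpsi] eqn bd0 _] := sol.
have [_ [[B HB] _] _ _] := C2.
pose S := [set alpha + lam * psi x | x in Omega].
have supS : has_sup S.
  split; first by exists (alpha + lam * psi x1), x1.
  exists (alpha + lam * B) => _ [x Ox <-].
  by rewrite lerD2l ler_wpM2l ?(ltW lam0)// (le_trans (ler_norm _))// HB.
pose M := sup S.
have uM x : Omega x -> alpha + lam * psi x <= M.
  by move=> Ox; apply: sup_upper_bound => //; exists x.
have M0 : 0 < M by exact: lt_le_trans ux1 (uM _ Ox1).
(* A point where [u] exceeds three quarters of its supremum is all that [scale_inequality] asks. *)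
have [_ [x0 Ox0 <-] ux0] : exists2 e, S e & M - M / 4 < e.
  by apply: sup_adherent => //; rewrite divr_gt0.
have MC : M <= C.
  apply: HC => // rho rho0.
  apply: (scale_inequality _ _ _ _ _ _ lam0 lamL alpha0 sol M0 uM Ox0) => //.
  by move: ux0; lra.
have psi_le x : Omega x -> psi x <= (C `^ p + 1) * D ^+ 2 / 2.
  apply: (@sup_le_laplacian _ _ _ beta) => //; first by rewrite 2?ltnW.
    exact: powR_ge0.
  move=> y Oy; rewrite eqn// /posp ge0_ler_powR ?nnegrE ?(ltW C0)//.
  - exact: le_trans p1.
  - by rewrite le_max lexx orbT.
  - by rewrite ge_max (ltW C0) andbT (le_trans (uM _ Oy)).
have K0 : 0 <= (C `^ p + 1) * D ^+ 2 / 2.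
  by rewrite !mulr_ge0 ?exprn_ge0 ?addr_ge0 ?powR_ge0// ltW.
have h1 := ler_wpM2l (ltW lam0) (psi_le _ Ox1).
have h2 := ler_wpM2r K0 lamL.
by move: ux1; lra.
Qed.

End Solution.

(** * The two limits along the sequence *)

Theorem theorem7p1 (R : realType) (N : nat) (p beta : R) (Omega : set 'rV[R]_N)
    (lambda alpha : nat -> R) (psi : nat -> 'rV[R]_N -> R) :
  (3 <= N)%N ->
  1 <= p -> p < N%:R / (N%:R - 2) ->
  0 < beta < 1 ->
  C2beta_bounded_domain beta Omega ->
  vol Omega = 1%E ->
  (forall n, 0 < lambda n) ->
  (forall n, solves_P Omega beta p (lambda n) (alpha n) (psi n)) ->
  (forall n, alpha n < 0) ->
  (fun n => `|alpha n|) @ \oo --> +oo ->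
  lambda @ \oo --> +oo /\
  (fun n => lambda n * supnorm Omega (psi n)) @ \oo --> +oo.
Proof.
move=> N3 p1 pN /andP[b0 _] [oO _ bO _] _ lam0 sol alpha0 /cvgryPgt alphaoo.
split; apply/cvgryPge => A.
(* If [lambda n] stayed below [A], [alpha_bound] would bound [alpha n]. The shift makes the
   threshold positive whatever the sign of [A]. *)
- have L0 : 0 < `|A| + 1 by rewrite ltr_wpDl.
  have [C HC] := alpha_bound N3 p1 pN b0 oO bO _ L0.
  near=> n; rewrite leNgt; apply/negP => lamA.
  have : C < `|alpha n| by near: n; exact: alphaoo.
  rewrite ltr0_norm// ltNge (HC (lambda n) _ (psi n))//.
  by rewrite (le_trans (ltW lamA))// (le_trans (ler_norm A))// lerDl.
- near=> n.
  have An : A < `|alpha n| by near: n; exact: alphaoo.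
  have [x Ox ux] := exists_plasma p1 _ _ _ (sol n).
  rewrite (le_trans (ltW An))// ltr0_norm//.
  apply: (@le_trans _ _ (lambda n * psi n x)); first by move: ux; lra.
  rewrite ler_wpM2l ?(ltW (lam0 n))// (le_trans (ler_norm _))//.
  (* Boundedness of [psi n] makes [supnorm] a true supremum instead of the default value of
     [sup]. *)
  have [[[_ [[B HB] _] _ _] _] _ _ _] := sol n.
  apply: sup_upper_bound; last by exists x.
  by split; [exists `|psi n x|, x|exists B => _ [y Oy <-]; exact: HB].
Unshelve. all: by end_near. Qed.
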